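(* $\operatorname{Ex}(\{W,W'\},n,m)\le 4n\alpha(n,m)+O(n+m)$, where $W$ is the $4\times5$ 0--1 matrix with rows (top to bottom) $(1,0,0,0,0)$, $(0,0,0,0,1)$, $(0,0,1,0,0)$, $(0,1,0,1,0)$, and $W'$ is its left–right reflection, with rows (top to bottom) $(0,0,0,0,1)$, $(1,0,0,0,0)$, $(0,0,1,0,0)$, $(0,1,0,1,0)$.
   Context: All matrices are 0--1 matrices, indexed with row 1 at the top. For a $k\times l$ matrix $P$ and an $n\times m$ matrix $A$, $P$ is contained in $A$ if there are rows $r_1<\dots<r_k$ and columns $c_1<\dots<c_l$ of $A$ with $P(i,j)=1\Rightarrow A(r_i,c_j)=1$; otherwise $A$ avoids $P$. For a set $\mathcal{P}$ of patterns, $\operatorname{Ex}(\mathcal{P},n,m)$ is the maximum number of 1s in an $n\times m$ 0--1 matrix avoiding every pattern in $\mathcal{P}$. Ackermann function: $a_{1,j}=2^j$ ($j\ge1$); $a_{i,1}=2$ ($i\ge2$); $a_{i,j}=w\cdot a_{i-1,w}$ with $w=a_{i,j-1}$ ($i,j\ge2$). $\alpha(n,m)=\min\{i\ge1:a_{i,j}\ge m\}$ where $j=\max\{3,\lceil n/m\rceil\}$. The implied constant in $O(n+m)$ is absolute. *)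

(* Defs.v *)
From mathcomp Require Import all_boot all_order all_algebra.

Set Implicit Arguments.
Unset Strict Implicit.
Unset Printing Implicit Defensive.

Notation mx01 n m := ('M[bool]_(n, m)).

Definition weight n m (A : mx01 n m) : nat :=
  #|[set ij : 'I_n * 'I_m | A ij.1 ij.2]|.

Definition increasing k n (f : {ffun 'I_k -> 'I_n}) : bool :=
  [forall i1 : 'I_k, forall i2 : 'I_k, (i1 < i2) ==> (f i1 < f i2)].

Definition contains k l n m (P : mx01 k l) (A : mx01 n m) : bool :=
  [exists r : {ffun 'I_k -> 'I_n}, exists c : {ffun 'I_l -> 'I_m},
    [&& increasing r, increasing c
      & [forall i, forall j, P i j ==> A (r i) (c j)]]].

(* Patterns in one family may have different dimensions. *)
Record pattern := Pattern {
  pat_rows : nat;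
  pat_cols : nat;
  pat_mx : mx01 pat_rows pat_cols
}.

Definition avoids (PP : seq pattern) n m (A : mx01 n m) : bool :=
  all (fun P => ~~ contains (pat_mx P) A) PP.

Definition Ex (PP : seq pattern) (n m : nat) : nat :=
  \max_(A : mx01 n m | avoids PP A) weight A.

Definition mx_of_rows k l (s : seq (seq nat)) : mx01 k l :=
  \matrix_(i < k, j < l) (nth 0 (nth [::] s i) j == 1).

Definition W : mx01 4 5 := mx_of_rows 4 5
  [:: [:: 1; 0; 0; 0; 0];
      [:: 0; 0; 0; 0; 1];
      [:: 0; 0; 1; 0; 0];
      [:: 0; 1; 0; 1; 0]].

Definition W' : mx01 4 5 := mx_of_rows 4 5
  [:: [:: 0; 0; 0; 0; 1];
      [:: 1; 0; 0; 0; 0];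
      [:: 0; 0; 1; 0; 0];
      [:: 0; 1; 0; 1; 0]].

Lemma W'_reflection i j : W' i j = W i (rev_ord j).
Proof.
by rewrite !mxE; case: i => [[|[|[|[|i]]]] Hi] //;
  case: j => [[|[|[|[|[|j]]]]] Hj].
Qed.

(* Indices start at 1; values with i = 0 or j = 0 are junk. *)
Fixpoint ack (i : nat) : nat -> nat :=
  match i with
  | 0 => fun=> 0
  | 1 => fun j => 2 ^ j
  | i'.+1 =>
      fix ack_i (j : nat) : nat :=
        match j with
        | 0 => 0
        | 1 => 2
        | j'.+1 => let w := ack_i j' in w * ack i' w
        end
  end.

Lemma ack1 j : ack 1 j = 2 ^ j.
Proof. by []. Qed.

Lemma ackn1 i : 2 <= i -> ack i 1 = 2.
Proof. by case: i => [|[|i]]. Qed.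

Lemma ackE i j : 2 <= i -> 2 <= j ->
  ack i j = ack i j.-1 * ack i.-1 (ack i j.-1).
Proof. by case: i => [|[|i]] //; case: j => [|[|j]]. Qed.

Lemma ack_lower i j : 1 <= i -> 1 <= j ->
  2 <= ack i j /\ (2 <= j -> 2 ^ i.+1 <= ack i j).
Proof.
case: i => // i _; elim: i j => [|i IHi] j j_gt0.
  by rewrite ack1; split=> [|j_ge2]; [apply: (@leq_pexp2l 2 1) | apply: leq_pexp2l].
elim: j j_gt0 => [|[|j] IHj] // _.
have [w_ge2 _] := IHj isT.
have [_ /(_ w_ge2) low] := IHi _ (ltnW w_ge2).
have {}low : 2 ^ i.+3 <= ack i.+2 j.+2.
  by rewrite ackE //= expnS leq_mul.
split=> //; apply: leq_trans low; exact: (@leq_pexp2l 2 1).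
Qed.

Definition ceil_div (n m : nat) : nat := n %/ m + ~~ (m %| n).

Lemma ceil_divP n m q : 0 < m -> (ceil_div n m <= q) = (n <= q * m).
Proof.
move=> m_gt0; rewrite /ceil_div; case: (boolP (m %| n)) => [/dvdnP[k ->]|ndvd] /=.
  by rewrite mulnK // addn0 leq_pmul2r.
rewrite addn1 ltn_divLR // [RHS]leq_eqVlt; case: eqP => // n_eq.
by rewrite n_eq dvdn_mull in ndvd.
Qed.

Definition alpha_col (n m : nat) : nat := maxn 3 (ceil_div n m).

Lemma alpha_exists n m : exists i, (1 <= i) && (m <= ack i (alpha_col n m)).
Proof.
have col_ge3 : 3 <= alpha_col n m by apply: leq_maxl.
exists m.+1 => /=.
have [_ /(_ (ltnW col_ge3)) low] := @ack_lower m.+1 _ isT (ltnW (ltnW col_ge3)).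
apply: leq_trans low; apply: ltnW; apply: leq_trans (ltn_expl m (isT : 1 < 2)) _.
by apply: leq_pexp2l => //; apply: leqW.
Qed.

Definition alpha (n m : nat) : nat := ex_minn (alpha_exists n m).

(* Main.v *)
Require Import Defs.
From mathcomp Require Import all_boot all_order all_algebra zify.

(** Let (s, y) be a one of a {W, W'}-free matrix, and let r < s be a row that
also has a one in column y. If two rows above r had ones to the left of some
one of s preceding y, and two rows above r had ones to the right of some one of
s following y, then distinct rows could be chosen on the two sides, giving W or
W'. Hence, up to O(n + m) ones, the matrix is covered by a left part and a
right part exchanged by reflection, and the left part avoids the
configurations Q formed by ones (r2, c3), (r3, c2), (r3, c4) with r2 < r3 and
c2 < c3 < c4, together with two further rows above r2 having ones to the left
of c2.

For a Q-free matrix, cut the columns into blocks. In a row meeting at least two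
blocks, keep the first one of each block: these are counted by the contracted
matrix. Among the other ones, drop the last one of the row and the last one in
its first block. By Q-freeness at most six of the remaining ones lie in each
column. The rows meeting several blocks thus cost 2 each more than in the
contracted matrix, so that the Ackermann recursion gives 2n per level for each
of the two parts. *)

Set Implicit Arguments.
Unset Strict Implicit.
Unset Printing Implicit Defensive.

(** * Counting tools *)

Lemma sum_pred_card (T : finType) (A P : pred T) :
  \sum_(x in A) P x = #|[set x in A | P x]|.
Proof. by rewrite -sum1dep_card big_mkcondr; apply: eq_bigr => x _; case: (P x). Qed.

Lemma sum_pred_le1 (T : finType) (P : pred T) :
  (forall x y, P x -> P y -> x = y) -> \sum_x P x <= 1.
Proof.
move=> uniqP; rewrite (eq_bigl (fun x => x \in predT)) // sum_pred_card.
apply/card_le1_eqP => x y; rewrite !inE /= => Px Py; exact: uniqP Py Px.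
Qed.

(** Indexing by [nat] lets later proofs write [r 0], [r 1], ... without ordinal indices. *)
Lemma card_gt_increasing k n (S : {set 'I_n}) : k < #|S| ->
  exists r : nat -> 'I_n, (forall i, i <= k -> r i \in S) /\
    (forall i j, i < j -> j <= k -> r i < r j).
Proof.
move=> lt_kS; have [r0 _] : exists r0, r0 \in S.
  by apply/set0Pn; rewrite -card_gt0; apply: leq_ltn_trans lt_kS.
exists (nth r0 (enum S)); split=> [i le_ik | i j lt_ij le_jk].
  by rewrite -mem_enum mem_nth // -cardE (leq_ltn_trans le_ik).
have ltn_trans' : transitive (fun x y : 'I_n => x < y).
  by move=> y x z; apply: ltn_trans.
have sorted_S : sorted (fun x y : 'I_n => x < y) (enum S).
  have: sorted ltn (map val (enum 'I_n)) by rewrite val_enum_ord iota_ltn_sorted.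
  by rewrite sorted_map enumT; apply: sorted_filter.
apply: (sorted_ltn_nth ltn_trans' r0 sorted_S) => //;
  by rewrite inE -cardE; apply: leq_ltn_trans lt_kS; lia.
Qed.

(** * Q-free matrices, blocks and contraction *)

(* Columns are indexed by nat so that blocks and contractions stay in the same
   type; only those below [m] count. *)
Definition wt n (R : {set 'I_n}) m (M : 'I_n -> nat -> bool) : nat :=
  \sum_(r in R) \sum_(c < m) M r c.

Definition Qfree n (R : {set 'I_n}) m (M : 'I_n -> nat -> bool) : Prop :=
  forall r0 r1 r2 r3, r0 \in R -> r1 \in R -> r2 \in R -> r3 \in R ->
  r0 < r1 -> r1 < r2 -> r2 < r3 ->
  forall c0 c1 c2 c3 c4, c0 < c2 -> c1 < c2 -> c2 < c3 -> c3 < c4 -> c4 < m ->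
  M r0 c0 -> M r1 c1 -> M r2 c3 -> M r3 c2 -> M r3 c4 -> False.

(** Each row costs [mu]; [K] pays for the columns and is the same for all row sets, so one bound
    serves every block. *)
Variant Qbound m mu K : Prop :=
  QBound of forall n (R : {set 'I_n}) M, Qfree R m M -> wt R m M <= mu * #|R| + K.

Definition block q (M : nat -> bool) (s : nat) : nat -> bool :=
  fun d => M (s * q + d).

Definition contract q (M : nat -> bool) (s : nat) : bool :=
  [exists d : 'I_q, M (s * q + d)].

Definition is_global m q (M : nat -> bool) : bool :=
  [exists c : 'I_m, exists c' : 'I_m,
    [&& M c, M c' & c %/ q != c' %/ q]].

Lemma sum_blocks p q (F : nat -> nat) :
  \sum_(c < p * q) F c = \sum_(s < p) \sum_(d < q) F (s * q + d).
Proof.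
rewrite -[LHS](big_mkord predT) big_nat_mul big_mkord; apply: eq_bigr => s _.
rewrite -{1}[s * q]add0n big_addn mulSn addnK big_mkord.
by apply: eq_bigr => d _; rewrite addnC.
Qed.

Lemma Qfree_sub n (R S : {set 'I_n}) m M :
  S \subset R -> Qfree R m M -> Qfree S m M.
Proof.
move=> /subsetP sSR free r0 r1 r2 r3 /sSR R0 /sSR R1 /sSR R2 /sSR R3.
exact: free.
Qed.

Lemma Qfree_block n (R : {set 'I_n}) p q s M : s < p ->
  Qfree R (p * q) M -> Qfree R q (fun r => block q (M r) s).
Proof.
move=> lt_sp free r0 r1 r2 r3 R0 R1 R2 R3 lt01 lt12 lt23 c0 c1 c2 c3 c4
  lt02 lt1 lt2 lt3 lt4.
by apply: (free r0 r1 r2 r3) => //; nia.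
Qed.

(** Ones in distinct blocks are ordered as their blocks, so a configuration of blocks lifts to one
    of columns. *)
Lemma Qfree_contract n (R : {set 'I_n}) p q M :
  Qfree R (p * q) M -> Qfree R p (fun r => contract q (M r)).
Proof.
move=> free r0 r1 r2 r3 R0 R1 R2 R3 lt01 lt12 lt23 s0 s1 s2 s3 s4
  lt02 lt1 lt2 lt3 lt4 /existsP[d0 M0] /existsP[d1 M1] /existsP[d2 M2]
  /existsP[d3 M3] /existsP[d4 M4].
move: (ltn_ord d0) (ltn_ord d1) (ltn_ord d2) (ltn_ord d3) (ltn_ord d4).
by move=> *; apply: (free r0 r1 r2 r3) M0 M1 M2 M3 M4 => //; nia.
Qed.

(** * Rows meeting several blocks *)

Section GlobalRows.

Variables (n p q : nat) (M : 'I_n -> nat -> bool) (G : {set 'I_n}).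
Hypothesis q_gt0 : 0 < q.
Hypothesis freeM : Qfree G (p * q) M.
Hypothesis globalG : forall r, r \in G -> is_global (p * q) q (M r).

Let N := p * q.

Let hasone r (P : pred nat) := [exists x : 'I_N, P x && M r x].

Let hasoneP r (P : pred nat) c : c < N -> P c -> M r c -> hasone r P.
Proof. by move=> c_lt Pc Mc; apply/existsP; exists (Ordinal c_lt); rewrite /= Pc. Qed.

Let same_left c := [pred x | (x < c) && (x %/ q == c %/ q)].
Let same_right c := [pred x | (c < x) && (x %/ q == c %/ q)].
Let earlier c := [pred x | x %/ q < c %/ q].
Let later c := [pred x | c %/ q < x %/ q].

(** Five classes, possibly overlapping: the first is charged to the contracted matrix, the next two
    to rows, the last two to columns. *)
Let first_in_block r c := M r c && ~~ hasone r (same_left c).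
Let last_in_row r c := M r c && ~~ hasone r [pred x | c < x].
Let last_in_first_block r c :=
  [&& M r c, ~~ hasone r (earlier c) & ~~ hasone r (same_right c)].
Let after_block r c := [&& M r c, hasone r (same_left c),
  hasone r (earlier c) & hasone r [pred x | c < x]].
Let inner_first_block r c := [&& M r c, hasone r (same_left c),
  hasone r (same_right c) & hasone r (later c)].

Let divlt a b : a %/ q < b %/ q -> a < b.
Proof. by apply: contraTT; rewrite -!leqNgt; apply: leq_div2r. Qed.

Let cover r c : r \in G -> M r c ->
  first_in_block r c + last_in_row r c + last_in_first_block r c
    + after_block r c + inner_first_block r c > 0.
Proof.
move=> /globalG /existsP[a /existsP[b /and3P[Ma Mb neq_ab]]] Mc.
rewrite /first_in_block /last_in_row /last_in_first_block /after_block.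
rewrite /inner_first_block Mc /=.
case: (boolP (hasone r (same_left c))) => //= _.
case: (boolP (hasone r [pred x | c < x])) => //= _.
case: (boolP (hasone r (earlier c))) => //= no_earlier.
case: (boolP (hasone r (same_right c))) => //= _.
(* The block of [c] is now the first one met, and the row meets two blocks, so [a] or [b] lies in a
   later block. *)
suff -> : hasone r (later c) by lia.
have le_cN x : x < N -> M r x -> c %/ q <= x %/ q.
  move=> ltx Mx; rewrite leqNgt; apply: contra no_earlier => ltxc.
  exact: hasoneP ltx _ Mx.
have le_ca := le_cN _ (ltn_ord a) Ma; have le_cb := le_cN _ (ltn_ord b) Mb.
have [lt_ca|ge_ca] := ltnP (c %/ q) (a %/ q).
  by rewrite (hasoneP (ltn_ord a)).
rewrite (hasoneP (ltn_ord b)) //=; move/eqP: neq_ab => neq_ab.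
by rewrite ltn_neqAle le_cb andbT; apply/eqP => e; apply: neq_ab; apply/eqP;
  rewrite eqn_leq -e le_ca ge_ca.
Qed.

Let sum_first r : \sum_(c < N) first_in_block r c <= \sum_(s < p) contract q (M r) s.
Proof.
rewrite /N (sum_blocks _ _ (first_in_block r)); apply: leq_sum => s _.
have ltN (d : 'I_q) : s * q + d < N.
  by have := ltn_ord d; have := ltn_ord s; rewrite /N; nia.
case: (boolP (contract q (M r) s)) => [_|/existsPn none] /=; last first.
  by rewrite big1 // => d _; rewrite /first_in_block (negbTE (none d)).
apply: sum_pred_le1 => d d' /andP[Md nd] /andP[Md' nd']; apply: val_inj => /=.
have same (a b : 'I_q) : (s * q + a) %/ q == (s * q + b) %/ q.
  by rewrite !divnMDl // !divn_small.
case: (ltngtP d d') => // lt_dd'.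
  by case/negP: nd'; apply: (hasoneP (ltN d)) Md; rewrite /= ltn_add2l lt_dd' same.
by case/negP: nd; apply: (hasoneP (ltN d')) Md'; rewrite /= ltn_add2l lt_dd' same.
Qed.

Let sum_last_in_row r : \sum_(c < N) last_in_row r c <= 1.
Proof.
apply: sum_pred_le1 => c d /andP[Mc nc] /andP[Md nd]; apply: val_inj => /=.
case: (ltngtP c d) => // lt_cd.
  by case/negP: nc; apply: (hasoneP (ltn_ord d)) Md.
by case/negP: nd; apply: (hasoneP (ltn_ord c)) Mc.
Qed.

Let sum_last_in_first_block r : \sum_(c < N) last_in_first_block r c <= 1.
Proof.
have key (c d : 'I_N) : last_in_first_block r c -> last_in_first_block r d -> ~~ (c < d).
  case/and3P=> [Mc _ nc] /and3P[Md nd _]; apply/negP => lt_cd.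
  have := leq_div2r q (ltnW lt_cd); rewrite [_ <= _]leq_eqVlt => /orP[/eqP e|lt].
    by case/negP: nc; apply: (hasoneP (ltn_ord d)) Md; rewrite /= lt_cd e eqxx.
  by case/negP: nd; apply: (hasoneP (ltn_ord c)) Mc.
apply: sum_pred_le1 => c d Lc Ld; apply: val_inj => /=.
by have := key c d Lc Ld; have := key d c Ld Lc; case: ltngtP.
Qed.

Let sum_rows_le3 (P : pred 'I_n) :
  (forall r0 r1 r2 r3, r0 \in G -> r1 \in G -> r2 \in G -> r3 \in G ->
    r0 < r1 -> r1 < r2 -> r2 < r3 -> P r0 -> P r1 -> P r2 -> P r3 -> False) ->
  \sum_(r in G) P r <= 3.
Proof.
move=> no4; rewrite (sum_pred_card (mem G)) leqNgt; apply/negP.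
case/card_gt_increasing => r [inS incr].
have in3 i : i <= 3 -> (r i \in G) && P (r i) by move/inS; rewrite inE.
have /andP[G0 P0] := in3 0 isT; have /andP[G1 P1] := in3 1 isT.
have /andP[G2 P2] := in3 2 isT; have /andP[G3 P3] := in3 3 isT.
by apply: (no4 (r 0) (r 1) (r 2) (r 3)) => //; apply: incr.
Qed.

(** Among four such rows, the lowest has ones [x < c < z] with [x] in the block of [c], the next
    supplies the one in column [c], and the upper two have ones in earlier blocks, hence left of
    [x]. *)
Let sum_after (c : 'I_N) : \sum_(r in G) after_block r c <= 3.
Proof.
apply: sum_rows_le3 => r0 r1 r2 r3 G0 G1 G2 G3 lt01 lt12 lt23.
case/and4P=> [_ _ /existsP[e0 /andP[/= lt0 M0]] _].
case/and4P=> [_ _ /existsP[e1 /andP[/= lt1 M1]] _].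
case/and4P=> [M2 _ _ _].
case/and4P=> [_ /existsP[x /andP[/andP[/= ltx /eqP ex] Mx]] _ /existsP[z /andP[/= ltz Mz]]].
by apply: (freeM G0 G1 G2 G3 lt01 lt12 lt23 _ _ ltx ltz (ltn_ord z) M0 M1 M2 Mx Mz);
  apply: divlt; rewrite ex.
Qed.

(** Here [c] is the left one of the lowest row and [z] its right one; the one [y] of the row above
    it stays in the block of [c], hence left of [z]. *)
Let sum_inner (c : 'I_N) : \sum_(r in G) inner_first_block r c <= 3.
Proof.
apply: sum_rows_le3 => r0 r1 r2 r3 G0 G1 G2 G3 lt01 lt12 lt23.
case/and4P=> [_ /existsP[e0 /andP[/andP[/= lt0 _] M0]] _ _].
case/and4P=> [_ /existsP[e1 /andP[/andP[/= lt1 _] M1]] _ _].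
case/and4P=> [_ _ /existsP[y /andP[/andP[/= lty /eqP ey] My]] _].
case/and4P=> [M3 _ _ /existsP[z /andP[/= ltz Mz]]].
apply: (freeM G0 G1 G2 G3 lt01 lt12 lt23 lt0 lt1 lty _ (ltn_ord z) M0 M1 My M3 Mz).
by apply: divlt; rewrite ey.
Qed.

Lemma wt_global :
  wt G N M <= wt G p (fun r => contract q (M r)) + 2 * #|G| + 6 * N.
Proof.
pose S (f : 'I_n -> nat -> bool) := \sum_(r in G) \sum_(c < N) f r c.
have split5 : wt G N M <= S first_in_block + S last_in_row + S last_in_first_block
    + S after_block + S inner_first_block.
  rewrite /S /wt -!big_split; apply: leq_sum => r Gr /=.
  rewrite -!big_split; apply: leq_sum => c _ /=.
  by case: (boolP (M r c)) => // Mc; apply: cover.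
have first_le : S first_in_block <= wt G p (fun r => contract q (M r)).
  exact: leq_sum.
have row_le (f : 'I_n -> nat -> bool) : (forall r, \sum_(c < N) f r c <= 1) -> S f <= #|G|.
  by move=> f_le; rewrite -sum1_card; apply: leq_sum.
have col_le (f : 'I_n -> nat -> bool) :
    (forall c : 'I_N, \sum_(r in G) f r c <= 3) -> S f <= 3 * N.
  move=> f_le; rewrite /S exchange_big /= mulnC -[X in X * 3]card_ord -sum_nat_const.
  exact: leq_sum.
have := row_le _ sum_last_in_row; have := row_le _ sum_last_in_first_block.
have := col_le _ sum_after; have := col_le _ sum_inner.
lia.
Qed.

End GlobalRows.

(** * Bounds by splitting the columns *)

Lemma Qbound_split p q mu K nu L : 0 < q -> nu + 2 <= mu ->
  Qbound q mu K -> Qbound p nu L -> Qbound (p * q) mu (p * K + L + 6 * (p * q)).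
Proof.
move=> q_gt0 le_nu [boundq] [boundp]; split=> n R M free.
pose G := [set r in R | is_global (p * q) q (M r)].
pose Rloc s := [set r in R :\: G | contract q (M r) s].
have sGR : G \subset R by apply/subsetP => r; rewrite inE => /andP[].
have sRR s : Rloc s \subset R.
  by apply/subsetP => r; rewrite !inE => /andP[/andP[]].
have wtD : wt R (p * q) M = wt G (p * q) M + wt (R :\: G) (p * q) M.
  rewrite /wt (big_setID G) /=; congr (_ + _); apply: eq_bigl => r.
  by rewrite inE; case: (boolP (r \in G)) => [/(subsetP sGR) ->|_]; rewrite ?andbF.
have cardD : #|R| = #|G| + #|R :\: G|.
  by rewrite -(cardsID G R); congr (_ + _); rewrite (setIidPr sGR).
(* The ones of a local row lie in a single block, so the row is paid for at most once. *)
have local_card : \sum_(s < p) #|Rloc s| <= #|R :\: G|.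
  under eq_bigr => s _ do rewrite -(sum_pred_card (mem (R :\: G))
    (fun r => contract q (M r) s)).
  rewrite exchange_big -sum1_card; apply: leq_sum => r /=.
  rewrite !inE => /andP[notG Rr]; apply: sum_pred_le1 => s s'.
  case/existsP=> d Md /existsP[d' Md']; apply: val_inj => /=.
  apply: contraNeq notG => neq_ss'; rewrite Rr.
  have ltN (t : 'I_p) (e : 'I_q) : t * q + e < p * q.
    by have := ltn_ord t; have := ltn_ord e; nia.
  apply/existsP; exists (Ordinal (ltN s d)); apply/existsP; exists (Ordinal (ltN s' d')).
  by rewrite /= Md Md' !divnMDl // !divn_small // !addn0.
have local_wt : wt (R :\: G) (p * q) M
    <= \sum_(s < p) wt (Rloc s) q (fun r => block q (M r) s).
  rewrite /wt (eq_bigr _ (fun r _ => sum_blocks _ _ (fun c => M r c : nat))).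
  rewrite exchange_big; apply: leq_sum => s _ /=.
  rewrite [X in _ <= X](eq_bigl (fun r => (r \in R :\: G) && contract q (M r) s)).
    rewrite big_mkcondr; apply: leq_sum => r _ /=.
    case: (boolP (contract q (M r) s)) => // /existsPn none.
    by rewrite big1 // => d _; rewrite (negbTE (none d)).
  by move=> r; rewrite inE.
have local_bound : \sum_(s < p) wt (Rloc s) q (fun r => block q (M r) s)
    <= mu * #|R :\: G| + p * K.
  apply: leq_trans (_ : \sum_(s < p) (mu * #|Rloc s| + K) <= _); last first.
    rewrite big_split /= -big_distrr /= sum_nat_const card_ord leq_add2r.
    by rewrite leq_mul2l local_card orbT.
  apply: leq_sum => s _; apply: boundq; apply: Qfree_block (ltn_ord s) _.
  exact: Qfree_sub (sRR s) free.
have freeG := Qfree_sub sGR free.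
have globalG r : r \in G -> is_global (p * q) q (M r) by rewrite inE => /andP[].
have le_global := wt_global q_gt0 freeG globalG.
have le_contracted := boundp _ G _ (Qfree_contract freeG).
rewrite wtD cardD.
(* A global row pays [nu] in the contracted matrix and 2 for its dropped ones. *)
have : (nu + 2) * #|G| <= mu * #|G| by rewrite leq_mul2r le_nu orbT.
lia.
Qed.

Lemma Qbound_le m mu mu' K K' : mu <= mu' -> K <= K' ->
  Qbound m mu K -> Qbound m mu' K'.
Proof.
move=> le_mu le_K [bound]; split=> n R M free.
by apply: leq_trans (bound _ _ _ free) _; rewrite leq_add ?leq_mul.
Qed.

Lemma Qbound_trivial m : Qbound m m 0.
Proof.
split=> n R M _; rewrite addn0 mulnC -sum_nat_const; apply: leq_sum => r _.
rewrite -[X in _ <= X](card_ord m) -sum1_card.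
by apply: leq_sum => c _; case: (M r c).
Qed.

(** With two blocks the contracted matrix costs at most 2 per row, which with the extra 2 explains
    [4 <= mu]. *)
Lemma Qbound_double q mu K : 0 < q -> 4 <= mu ->
  Qbound q mu K -> Qbound (2 * q) mu (2 * K + 12 * q).
Proof.
move=> q_gt0 mu_ge4 boundq.
have -> : 2 * K + 12 * q = 2 * K + 0 + 6 * (2 * q) by lia.
exact: Qbound_split (Qbound_trivial 2).
Qed.

Lemma Qbound_pow2 k : Qbound (2 ^ k) 4 (6 * k * 2 ^ k).
Proof.
elim: k => [|k IHk]; first by apply: Qbound_le (Qbound_trivial 1).
rewrite expnS; apply: Qbound_le (Qbound_double _ _ IHk) => //; last by rewrite expn_gt0.
by nia.
Qed.

(** * The Ackermann recursion *)

Lemma ack_pow2 i j : 0 < i -> 0 < j -> exists e, ack i j = 2 ^ e.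
Proof.
case: i => // i _; elim: i j => [|i IHi] j; first by exists j.
elim: j => [|[|j] IHj] // _; first by exists 1.
have [e def_w] := IHj isT; rewrite ackE // -[j.+2.-1]/(j.+1) -[i.+2.-1]/(i.+1) def_w.
have [|f ->] := IHi (2 ^ e); first by rewrite expn_gt0.
by exists (e + f); rewrite expnD.
Qed.

(* Blocks of width [2 * ack i j.-1] rather than [ack i j.-1] halve the column
   cost of the contraction, which leaves room for the overhead of splitting. *)
Lemma Qbound_ack i j k : 0 < i -> 0 < j -> 2 ^ k <= ack i j ->
  Qbound (2 ^ k) (2 * i + 2) (24 * j * 2 ^ k).
Proof.
case: i => // i _; elim: i j k => [|i IHi] j k.
  rewrite ack1 leq_exp2l // => _ le_kj; apply: Qbound_le (Qbound_pow2 k) => //.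
  by rewrite leq_mul2r; apply/orP; right; lia.
elim: j k => [|[|j] IHj] // k _.
  rewrite ackn1 // => le_k; apply: Qbound_le (Qbound_trivial (2 ^ k)) => //; lia.
rewrite ackE // -[j.+2.-1]/(j.+1) -[i.+2.-1]/(i.+1) => le_k.
have [l def_w] := @ack_pow2 i.+2 j.+1 isT isT.
(* At most [2 ^ l] columns are already covered by the preceding [j]; otherwise blocks of width
   [2 * 2 ^ l] divide [2 ^ k] exactly. *)
rewrite def_w in le_k IHj; have [le_kl|lt_lk] := leqP k l.
  apply: Qbound_le (IHj k isT _) => //; first by rewrite leq_mul2r; apply/orP; right; lia.
  by rewrite leq_exp2l.
have w_gt0 : 0 < 2 ^ l by rewrite expn_gt0.
have [p def_p] : {p | 2 ^ k = 2 ^ p * (2 * 2 ^ l)}.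
  by exists (k - l.+1); rewrite -expnS -expnD subnK.
have local := Qbound_double w_gt0 (_ : 4 <= 2 * i.+2 + 2) (IHj l isT (leqnn _)).
(* The lower level is used with [2 ^ l] in place of [j]; its column cost equals [12 * 2 ^ k]. *)
have contracted : Qbound (2 ^ p) (2 * i.+1 + 2) (24 * 2 ^ l * 2 ^ p).
  by apply: IHi => //; rewrite -(leq_pmul2l w_gt0); apply: leq_trans le_k; rewrite def_p; nia.
have lw : 0 < 2 * 2 ^ l by lia.
(* In units of [2 ^ k], blocks cost [24 * j.+1 + 6], the contracted matrix 12 and the splitting 6:
   in all [24 * j.+2]. *)
rewrite def_p; apply: Qbound_le (Qbound_split lw _ (local _) contracted) => //; [|lia|lia].
nia.
Qed.

(** * From W and W' to Q-free matrices *)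

Section Reduction.

Variables n m : nat.
Implicit Type A : 'I_n -> 'I_m -> bool.

(** Leaving [a] and [b] unordered treats both patterns at once: [a] above [b] gives W, [b] above [a]
    gives W'. *)
Definition Wfree A : Prop :=
  forall (a b r s : 'I_n) (c1 c2 c3 c4 c5 : 'I_m),
  a != b -> a < r -> b < r -> r < s -> c1 < c2 -> c2 < c3 -> c3 < c4 -> c4 < c5 ->
  A a c1 -> A b c5 -> A r c3 -> A s c2 -> A s c4 -> False.

Definition mirror A r c := A r (rev_ord c).

Lemma Wfree_mirror A : Wfree A -> Wfree (mirror A).
Proof.
move=> free a b r s c1 c2 c3 c4 c5 neq_ab lt_ar lt_br lt_rs lt1 lt2 lt3 lt4.
move=> A1 A5 A3 A2 A4; rewrite eq_sym in neq_ab.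
by apply: (free b a r s) neq_ab _ _ _ _ _ _ _ A5 A1 A3 A4 A2 => //=;
  move: (ltn_ord c2) (ltn_ord c3) (ltn_ord c4) (ltn_ord c5); lia.
Qed.

Definition left_of A r y a :=
  [exists x : 'I_m, exists c : 'I_m, [&& x < y, A r x, c < x & A a c]].

(* The row [b] is what makes the left part Q-free: it lies above [rho], hence
   above any row below [rho], and supplies the rightmost one of W or W'. *)
Definition left_type A r y :=
  A r y && [exists rho : 'I_n, [&& rho < r, A rho y,
    [exists b : 'I_n, exists c : 'I_m, [&& b < rho, y < c & A b c]]
    & #|[set a : 'I_n | (a < rho) && left_of A r y a]| <= 1]].

(** Zero columns are appended, so that the width can be rounded up to a power of two. *)
Definition extend A r (c : nat) :=
  [exists d : 'I_m, (d == c :> nat) && A r d].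

(** Take [rho] and [b] for the one [(r3, c4)]. If [r1] is above [rho], then [r0] and [r1] are two
    rows where at most one is allowed; otherwise [b] is above [r1], and [r1], [b], [r2], [r3] form W
    or W'. *)
Lemma Qfree_left_type A N :
  Wfree A -> Qfree setT N (extend (left_type A)).
Proof.
move=> free r0 r1 r2 r3 _ _ _ _ lt01 lt12 lt23 ? ? ? ? ? lt0 lt1 lt2 lt3 _.
case/existsP=> c0 /andP[/eqP e0 /andP[A0 _]]; case/existsP=> c1 /andP[/eqP e1 /andP[A1 _]].
case/existsP=> c3 /andP[/eqP e3 /andP[A3 _]]; case/existsP=> c2 /andP[/eqP e2 /andP[A2 _]].
case/existsP=> c4 /andP[/eqP e4 /andP[A4]].
case/existsP=> rho /and4P[_ _ /existsP[b /existsP[c5 /and3P[lt_b lt5 A5]]] le1].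
subst; have [lt1rho|le_rho1] := ltnP r1 rho; last first.
  apply: (free r1 b r2 r3 c1 c2 c3 c4 c5) => //; last by lia.
  by apply/eqP => e; rewrite -e in lt_b; lia.
have inS (a : 'I_n) (c : 'I_m) : a < rho -> c < c2 -> A a c ->
    a \in [set a : 'I_n | (a < rho) && left_of A r3 c4 a].
  move=> lt_a lt_c Aac; rewrite inE lt_a; apply/existsP; exists c2.
  by apply/existsP; exists c; rewrite A2 lt_c Aac (ltn_trans lt2).
have := card_le1_eqP le1 r0 r1 (inS r0 c0 (ltn_trans lt01 lt1rho) lt0 A0) (inS r1 c1 lt1rho lt1 A1).
by move=> e; rewrite e ltnn in lt01.
Qed.

Let sum2 A := \sum_r \sum_c A r c.

(** Beyond the first and last ones of rows, each column has at most two ones of neither type. *)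
Lemma left_type_cover A : Wfree A ->
  sum2 A <= sum2 (left_type A) + sum2 (left_type (mirror A)) + 2 * n + 2 * m.
Proof.
move=> free; set L := left_type A; set L' := left_type (mirror A).
pose first r (c : 'I_m) := A r c && ~~ [exists x : 'I_m, (x < c) && A r x].
pose last r (c : 'I_m) := A r c && ~~ [exists x : 'I_m, (c < x) && A r x].
pose rest r (c : 'I_m) := [&& A r c, ~~ L r c, ~~ L' r (rev_ord c),
  [exists x : 'I_m, (x < c) && A r x] & [exists x : 'I_m, (c < x) && A r x]].
have -> : sum2 L' = sum2 (mirror L').
  by apply: eq_bigr => r _; rewrite (reindex_inj rev_ord_inj).
have split5 : sum2 A <= sum2 L + sum2 (mirror L') + sum2 first + sum2 last + sum2 rest.
  rewrite /sum2 -!big_split; apply: leq_sum => r _ /=.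
  rewrite -!big_split; apply: leq_sum => c _ /=; rewrite /first /last /rest /mirror.
  case: (A r c) => //=; case: (L r c) => //=; case: (L' r _) => //=.
  by case: existsP => //= _; case: existsP.
have row_le (B : 'I_n -> 'I_m -> bool) : (forall r, \sum_c B r c <= 1) -> sum2 B <= n.
  by move=> B_le; rewrite -[n in _ <= n]card_ord -sum1_card; apply: leq_sum.
have first_le : sum2 first <= n.
  apply: row_le => r; apply: sum_pred_le1 => x y /andP[Ax /existsPn nx] /andP[Ay /existsPn ny].
  have := nx y; have := ny x; rewrite Ax Ay !andbT => lex ley.
  by apply: val_inj; case: ltngtP lex ley.
have last_le : sum2 last <= n.
  apply: row_le => r; apply: sum_pred_le1 => x y /andP[Ax /existsPn nx] /andP[Ay /existsPn ny].
  have := nx y; have := ny x; rewrite Ax Ay !andbT => lex ley.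
  by apply: val_inj; case: ltngtP lex ley.
suff rest_le : sum2 rest <= 2 * m by lia.
rewrite /sum2 exchange_big /= mulnC -[m in m * 2]card_ord -sum_nat_const.
apply: leq_sum => c _; rewrite (eq_bigl (fun r => r \in predT)) // sum_pred_card leqNgt.
apply/negP => /card_gt_increasing[r [inS incr]].
have in2 i : i <= 2 -> rest (r i) c by move/inS; rewrite inE.
have lt01 := incr 0 1 isT isT; have lt12 := incr 1 2 isT isT.
have /and5P[A2 notL notL' _ _] := in2 2 isT; have /andP[A1 _] := in2 1 isT.
have /and5P[_ _ _ /existsP[x /andP[lt_x Ax]] /existsP[z /andP[lt_z Az]]] := in2 0 isT.
move: (r 0) (r 1) (r 2) lt01 lt12 A1 A2 Ax Az notL notL' => r0 r1 r2 lt01 lt12 A1 A2 Ax Az.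
(* With [r1] as [rho], row [r0] supplies [b] on either side; so both types can fail at [r2] only
   through the cardinality condition. *)
rewrite /L /left_type A2 /= => /existsPn/(_ r1).
rewrite lt12 A1 (_ : [exists b, _]) /=; last first.
  by apply/existsP; exists r0; apply/existsP; exists z; rewrite lt01 lt_z.
rewrite -ltnNge => two_left.
rewrite /L' /left_type /mirror rev_ordK A2 /= => /existsPn/(_ r1).
rewrite lt12 A1 (_ : [exists b, _]) /=; last first.
  apply/existsP; exists r0; apply/existsP; exists (rev_ord x).
  by rewrite lt01 rev_ordK Ax andbT /=; have := ltn_ord c; lia.
rewrite -ltnNge => two_right.
have [a] : exists a, a \in [set a : 'I_n | (a < r1) && left_of A r2 c a].
  by apply/set0Pn; rewrite -card_gt0 ltnW.
rewrite inE => /andP[lt_a /existsP[x2 /existsP[c1 /and4P[lt_x2 Ax2 lt_c1 Ac1]]]].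
(* Two rows are available on the right, so one differs from [a]. *)
have [b] : exists b, b \in [set b : 'I_n | (b < r1)
    && left_of (fun r c => A r (rev_ord c)) r2 (rev_ord c) b] :\ a.
  apply/set0Pn; apply: contraTneq two_right => S0.
  by rewrite (cardsD1 a) S0 cards0 addn0 -leqNgt leq_b1.
rewrite !inE => /and3P[neq_ba lt_b /existsP[x4 /existsP[c5 /and4P[lt_x4 Ax4 lt_c5 Ac5]]]].
apply: (free a b r1 r2 c1 x2 c (rev_ord x4) (rev_ord c5)) => //; first by rewrite eq_sym.
  by move: lt_x4 => /=; have := ltn_ord c; have := ltn_ord x4; lia.
by move: lt_c5 => /=; have := ltn_ord c5; have := ltn_ord x4; lia.
Qed.

Lemma sum2_extend A N : m <= N -> sum2 A <= wt setT N (extend A).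
Proof.
move=> le_mN; rewrite /wt [X in _ <= X]big_mkcond; apply: leq_sum => r _.
rewrite in_setT; apply: (@leq_trans (\sum_(c < m) extend A r c)).
  apply: leq_sum => c _; case: (boolP (A r c)) => // Ac.
  by rewrite lt0b; apply/existsP; exists c; rewrite eqxx.
rewrite (big_ord_widen _ (fun c => extend A r c : nat) le_mN) big_mkcond.
by apply: leq_sum => c _; case: (_ < m).
Qed.

End Reduction.

(** * Pattern containment and the final bound *)

Lemma contains_intro k l n m (P : mx01 k l) (A : mx01 n m)
    (r : 'I_k -> 'I_n) (c : 'I_l -> 'I_m) :
  (forall i j : 'I_k, i < j -> r i < r j) ->
  (forall i j : 'I_l, i < j -> c i < c j) ->
  (forall i j, P i j -> A (r i) (c j)) -> contains P A.
Proof.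
move=> incr incc sub; apply/existsP; exists [ffun i => r i].
apply/existsP; exists [ffun j => c j]; apply/and3P; split.
- apply/forallP => i; apply/forallP => j; rewrite !ffunE; apply/implyP; exact: incr.
- apply/forallP => i; apply/forallP => j; rewrite !ffunE; apply/implyP; exact: incc.
by apply/forallP => i; apply/forallP => j; rewrite !ffunE; apply/implyP; apply: sub.
Qed.

Lemma avoids_Wfree n m (A : mx01 n m) :
  avoids [:: Pattern W; Pattern W'] A -> Wfree (fun r c => A r c).
Proof.
case/and3P=> /negP noW /negP noW' _ a b r s c1 c2 c3 c4 c5.
move=> neq_ab lt_ar lt_br lt_rs lt1 lt2 lt3 lt4 A1 A5 A3 A2 A4.
pose c (j : 'I_5) := nth c1 [:: c1; c2; c3; c4; c5] j.
have incc (i j : 'I_5) : i < j -> c i < c j.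
  by case: i j => [[|[|[|[|[|?]]]]] ?] [[|[|[|[|[|?]]]]] ?] //= _; rewrite /c /=; lia.
have [lt_ab|lt_ba|] := ltngtP a b; last by move/val_inj/eqP; rewrite (negbTE neq_ab).
- apply: noW; apply: (contains_intro (r := fun i : 'I_4 => nth a [:: a; b; r; s] i) _ incc).
    by case=> [[|[|[|[|?]]]] ?] [[|[|[|[|?]]]] ?] //= _; lia.
  case=> [[|[|[|[|?]]]] ?] [[|[|[|[|[|?]]]]] ?] //=; rewrite mxE //.
apply: noW'; apply: (contains_intro (r := fun i : 'I_4 => nth a [:: b; a; r; s] i) _ incc).
  by case=> [[|[|[|[|?]]]] ?] [[|[|[|[|?]]]] ?] //= _; lia.
case=> [[|[|[|[|?]]]] ?] [[|[|[|[|[|?]]]]] ?] //=; rewrite mxE //.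
Qed.

Lemma weight_sum n m (A : mx01 n m) : weight A = \sum_r \sum_c A r c.
Proof.
rewrite /weight -sum1dep_card big_mkcond /=.
rewrite (pair_bigA _ (fun r c => A r c : nat)) /=.
by apply: eq_bigr => -[r c] _ /=; case: (A r c).
Qed.

Theorem theorem17 :
  exists C : nat, forall n m : nat, 0 < n -> 0 < m ->
    Ex [:: Pattern W; Pattern W'] n m <= 4 * n * alpha n m + C * (n + m).
Proof.
(* The two sides and the cover give [4 * i * n + 102 * n + 386 * m]. *)
exists 390 => n m n_gt0 m_gt0; apply/bigmax_leqP => A /avoids_Wfree free.
rewrite weight_sum; apply: leq_trans (left_type_cover free) _.
rewrite /alpha; case: ex_minnP => i /andP[i_gt0 le_m] _.
set j := alpha_col n m in le_m *.
have j_gt0 : 0 < j by rewrite leq_max.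
have le_jm : j * m <= n + 4 * m.
  rewrite /j /alpha_col maxnMl geq_max; apply/andP; split; first by nia.
  rewrite /ceil_div mulnDl; have := leq_trunc_div n m.
  by case: (~~ _); lia.
(* Rounding [m] up to a power of two does not pass [ack i j], itself a power of two. *)
have le_k : 2 ^ up_log 2 m <= ack i j.
  have [e def_a] := ack_pow2 i_gt0 j_gt0; rewrite def_a in le_m *.
  by rewrite leq_exp2l // up_log_min.
have lt_k : 2 ^ up_log 2 m <= 2 * m.
  have [m1|m_gt1] := leqP m 1; first by have -> : m = 1 by lia.
  have /andP[lt_pred _] := up_log_bounds (isT : 1 < 2) m_gt1.
  have := up_log_gt0 2 m; case: (up_log 2 m) lt_pred => [|k] /=; rewrite ?expnS; lia.
have [bound] := Qbound_ack i_gt0 j_gt0 le_k.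
have side (B : 'I_n -> 'I_m -> bool) : Wfree B ->
    \sum_r \sum_c left_type B r c
      <= (2 * i + 2) * n + 48 * (n + 4 * m).
  move=> freeB; have le_mk : m <= 2 ^ up_log 2 m by apply: up_logP.
  apply: leq_trans (sum2_extend (left_type B) le_mk) _.
  apply: leq_trans (bound _ _ _ (Qfree_left_type freeB)) _.
  rewrite cardsT card_ord leq_add2l; nia.
have := side _ free; have := side _ (Wfree_mirror free).
lia.
Qed.
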